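(* Let $X$ be $c_0(\mathbb{R})$ or $l^p(\mathbb{R})$, $1 \leq p < +\infty$, let $0 < c < c'$, let $(\alpha_n)_{n\ge1}$ be a sequence with $\alpha_n \in (c,c')$ for each $n \in \mathbb{N}$, and let $L : X \to X$ be the weighted shift $L((x_n)_{n\ge1}) = (\alpha_n x_{n+1})_{n\ge1}$. For $k,n\in\mathbb{N}$ put $\beta_k^n := \alpha_k \cdots \alpha_{k+n-1}$ and $d_n := \inf\{\beta_k^n : k \in \mathbb{N}\}$. Assume that one of the following conditions is satisfied: i) $\lim_{n \to +\infty} (d_n)^{-\frac{1}{n}} < 1$; ii) $\sup\bigl\{ \sum_{n = 1}^{+\infty} (\beta_k^n)^{-1} : k \in \mathbb{N} \bigr\} < +\infty$. Let $\alpha \in (0,1]$ and let $\nu$ be an a priori probability measure on $\mathrm{Ker}(L)$ with full support and strong adapted tails. Then, for each bounded above potential $A \in \mathcal{H}_{\alpha}(X) \cap \mathcal{SV}_L(X)$, the Gibbs state $\mu_A$ associated with $A$ satisfies $$\log(\lambda_A) = h_\nu(\mu_A) + \int_X A\, d\mu_A = P_\nu(A),$$ where $\lambda_A$ is the main eigenvalue of the Ruelle operator $\mathcal{L}_A$.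
   Context: $\mathbb{N} = \{1,2,\dots\}$. $c_0(\mathbb{R})$ has the sup norm and $l^p(\mathbb{R})$ its usual norm; $(e_k)$ is the standard basis. Here $\mathrm{Ker}(L^n) = \mathrm{span}\{e_1,\dots,e_n\}$, $E_n := \{x \in X : x_1 = \dots = x_n = 0\}$, so $X = \mathrm{Ker}(L^n) \oplus E_n$, and $p(L^n) := \inf\{\|L^n x\|_X : \|x\|_X = 1, x \in E_n\} = d_n$. $\mathrm{Ker}(L) = \mathbb{R}e_1$ is identified with $\mathbb{R}$. $\mathcal{C}(X)$ (resp. $\mathcal{C}_b(X)$) is the set of continuous (resp. bounded continuous) functions $X \to \mathbb{R}$. $\mathcal{H}_\alpha(X)$ is the set of $\varphi \in \mathcal{C}(X)$ with $\sup_{x\neq y} |\varphi(x)-\varphi(y)|/\|x-y\|_X^\alpha < +\infty$; $\mathcal{H}_{b,\alpha}(X)$ is the set of its bounded elements. $\mathcal{SV}_L(X)$ is the set of $A \in \mathcal{C}(X)$ with $\sum_{n\ge1} V_{L,n}(A) < +\infty$, where $V_{L,n}(A) := \sup\{|A(z_n + x_n) - A(z_n + y_n)| : z_n \in \mathrm{Ker}(L^n),\ x_n, y_n \in E_n\}$. A priori measure: $\nu$ is a Borel probability measure on $\mathrm{Ker}(L) \cong \mathbb{R}$ whose support is all of $\mathbb{R}$. It has strong adapted tails if for every $\epsilon > 0$ there is a sequence of positive numbers $(\kappa_n)_{n\ge1} \in l^1(\mathbb{R})$ with $\sum_{n\ge1} \nu([-d_n\kappa_n, d_n\kappa_n]^c)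 < \epsilon$. Ruelle operator: for a bounded above $A \in \mathcal{H}_\alpha(X)$ and $\varphi \in \mathcal{C}_b(X)$, $\mathcal{L}_A(\varphi)(x_1,x_2,\dots) := \int_{\mathbb{R}} e^{A(r, x_1/\alpha_1, x_2/\alpha_2, \dots)} \varphi(r, x_1/\alpha_1, x_2/\alpha_2, \dots)\, d\nu(r)$. $\mathcal{L}_0$ is the operator for the potential $0$. The dual $\mathcal{L}_A^*$ acts on finite Borel measures by $\int \varphi\, d(\mathcal{L}_A^*\mu) = \int \mathcal{L}_A(\varphi)\, d\mu$ for $\varphi \in \mathcal{C}_b(X)$. For a bounded above $A \in \mathcal{H}_\alpha(X) \cap \mathcal{SV}_L(X)$ there are (Ruelle–Perron–Frobenius theorem) an eigenvalue $\lambda_A > 0$ (the main eigenvalue) and a strictly positive $\psi_A \in \mathcal{H}_{b,\alpha}(X)$ with $\mathcal{L}_A(\psi_A) = \lambda_A \psi_A$. The associated normalized potential is $\overline{A} := A + \log \psi_A - \log(\psi_A \circ L) - \log \lambda_A$, which satisfies $\mathcal{L}_{\overline{A}}(1) = 1$. The Gibbs state $\mu_A$ is the Borel ($L$-invariant) probability measure with $\mathcal{L}_{\overline{A}}^* \mu_A = \mu_A$. $\mathcal{P}_L(X)$ is the set of $L$-invariant Borel probability measures on $X$. For $\mu \in \mathcal{P}_L(X)$, $h_\nu(\mu) := \inf\{\int_X \log(\mathcal{L}_0(u)/u)\, d\mu : u \in \mathcal{C}_b(X),\ u > 0\}$, and $P_\nu(A) := \sup\{h_\nu(\mu) + \int_X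 A\, d\mu : \mu \in \mathcal{P}_L(X)\}$. *)

(* Defs.v *)
From HB Require Import structures.
From mathcomp Require Import all_boot all_order all_algebra.
From mathcomp Require Import all_classical all_reals all_analysis.

Set Implicit Arguments.
Unset Strict Implicit.
Unset Printing Implicit Defensive.

Import Order.TTheory GRing.Theory Num.Theory.
Import numFieldNormedType.Exports.

Local Open Scope classical_set_scope.
Local Open Scope ring_scope.

(* Sequences (x_1, x_2, ...) are indexed from 0: [x k] is the coordinate
   x_(k+1), and likewise [a k] is the weight alpha_(k+1). *)

Section seq_spaces.
Context {R : realType}.

Variant seq_space := c0_space | lp_space (p : R) of 1 <= p.

(* With respect to [counting], the L^p norm is (\sum_k |x_k|^p)^(1/p), see
   [Lnorm_counting]. *)
Definition in_seq_space (S : seq_space) : set (nat -> R) :=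
  match S with
  | c0_space => [set x | x @ \oo --> 0]
  | lp_space p _ => [set x | finite_norm counting p%:E x]
  end.

Definition seq_norm (S : seq_space) (x : nat -> R) : R :=
  match S with
  | c0_space => sup (range (fun k => `|x k|))
  | lp_space p _ => fine 'N[counting]_(p%:E)[EFin \o x]
  end.

Definition seq_pred (S : seq_space) : {pred nat -> R} :=
  mem (in_seq_space S).

Definition seqs (S : seq_space) := {x : nat -> R | x \in seq_pred S}.

HB.instance Definition _ S := SubType.on (seqs S).
HB.instance Definition _ S := Choice.on (seqs S).

Lemma nat_mfun (f : nat -> R) : measurable_fun [set: nat] f.
Proof. by []. Qed.

Lemma lp_inLfun p (p1 : 1 <= p) (x : nat -> R) :
  in_seq_space (lp_space p1) x -> x \in Lfun counting p%:E.
Proof.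
move=> xp; rewrite inE; apply/andP; split.
  by rewrite inE; exact: nat_mfun.
by rewrite inE.
Qed.

Lemma lp_normZ p (p1 : 1 <= p) l (x : nat -> R) :
  in_seq_space (lp_space p1) x ->
  ('N[counting]_(p%:E)[EFin \o (l *: x)%R] =
   `|l|%:E * 'N[counting]_(p%:E)[EFin \o x])%E.
Proof.
move=> /lp_inLfun xL.
have p1' : (1 <= p%:E)%E by rewrite lee_fin.
exact: (LnormZ (Lfun_Sub p1' xL) l).
Qed.

Lemma seq_pred_submod (S : seq_space) : submod_closed (seq_pred S).
Proof.
case: S => [|p p1]; split => /=.
- by rewrite inE/=; exact: cvg_cst.
- move=> l x y; rewrite !inE/= => x0 y0.
  rewrite -[0 in X in _ --> X](addr0 0) -[0 in X in _ --> X + _](scaler0 _ l).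
  by apply: cvgD => //; exact: cvgZr.
- rewrite inE/= /finite_norm (_ : EFin \o _ = cst 0%E)//.
  by rewrite Lnorm0 ?ltry// eqe gt_eqF// (lt_le_trans ltr01).
- move=> l x y; rewrite !inE/= => xp yp.
  apply: (le_lt_trans (eminkowski counting (nat_mfun (l *: x)) (nat_mfun y) _)).
    by rewrite lee_fin.
  rewrite lte_add_pinfty// (@lp_normZ p p1)// lte_mul_pinfty//.
Qed.

HB.instance Definition _ S :=
  GRing.isSubmodClosed.Build _ _ (seq_pred S) (seq_pred_submod S).
HB.instance Definition _ S := [SubChoice_isSubLmodule of seqs S by <:].

Definition coords S (x : seqs S) : nat -> R := val x.

Lemma seqsP S (x : seqs S) : in_seq_space S (val x).
Proof. by have := valP x; rewrite inE. Qed.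

Lemma lp_fin_num p (p1 : 1 <= p) (x : seqs (lp_space p1)) :
  'N[counting]_(p%:E)[EFin \o val x]%E \is a fin_num.
Proof. by rewrite ge0_fin_numE ?Lnorm_ge0//; have := seqsP x. Qed.

Lemma c0_has_sup (x : nat -> R) : in_seq_space c0_space x ->
  has_ubound (range (fun k => `|x k|)).
Proof.
move=> /= x0.
have /cvg_seq_bounded : cvgn x by apply/cvg_ex; exists 0.
move=> [M [_ xM]].
by exists (M + 1) => _ [k _ <-]; apply: xM => //; rewrite ltrDl.
Qed.

Lemma seq_norm_ge0 S (x : seqs S) : 0 <= seq_norm S (val x).
Proof.
case: S x => [|p p1] x /=; last by apply: fine_ge0; exact: Lnorm_ge0.
have xub := c0_has_sup (seqsP x).
by apply: (le_trans (normr_ge0 (val x 0%N))); apply: ub_le_sup => //; exists 0%N.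
Qed.

Lemma seq_normD S (x y : seqs S) :
  seq_norm S (val (x + y)) <= seq_norm S (val x) + seq_norm S (val y).
Proof.
case: S x y => [|p p1] x y.
- apply: ge_sup; first by exists (`|val (x + y) 0%N|), 0%N.
  move=> _ [k _ <-]; apply: (le_trans (ler_normD _ _)); apply: lerD.
    by apply: ub_le_sup; [exact: c0_has_sup (seqsP x)|exists k].
  by apply: ub_le_sup; [exact: c0_has_sup (seqsP y)|exists k].
- rewrite /= -fineD ?lp_fin_num// fine_le ?fin_numD ?lp_fin_num//.
    exact: (lp_fin_num (x + y)).
  have p1E : (1 <= p%:E)%E by rewrite lee_fin.
  exact: (eminkowski counting (nat_mfun (val x)) (nat_mfun (val y)) p1E).
Qed.

Lemma seq_normZ S l (x : seqs S) :
  seq_norm S (val (l *: x)) = `|l| * seq_norm S (val x).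
Proof.
case: S x => [|p p1] x.
- have le_sup (m : R) (z : seqs c0_space) :
      seq_norm c0_space (val (m *: z)) <= `|m| * seq_norm c0_space (val z).
    apply: ge_sup; first by exists (`|val (m *: z) 0%N|), 0%N.
    move=> _ [k _ <-]; rewrite [X in X <= _]normrM ler_wpM2l//.
    by apply: ub_le_sup; [exact: c0_has_sup (seqsP z)|exists k].
  apply/eqP; rewrite eq_le le_sup andTb.
  have [->|l0] := eqVneq l 0; first by rewrite normr0 mul0r; apply: (seq_norm_ge0 (0 *: x)).
  have := le_sup l^-1 (l *: x); rewrite scalerA mulVf// scale1r => H.
  apply: (le_trans (ler_wpM2l (normr_ge0 l) H)).
  by rewrite normfV mulrA divff ?mul1r ?normr_eq0.
- rewrite [LHS]/= (lp_normZ l (seqsP x)) fineM ?lp_fin_num//.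
Qed.

Lemma seq_norm0_eq0 S (x : seqs S) : seq_norm S (val x) = 0 -> x = 0.
Proof.
case: S x => [|p p1] x x0; apply/val_inj/funext => k /=.
- apply/eqP; rewrite -normr_eq0 eq_le normr_ge0 andbT -x0.
  by apply: ub_le_sup; [exact: c0_has_sup (seqsP x)|exists k].
- have p0 : 0 < p by rewrite (lt_le_trans ltr01).
  have : 'N[counting]_(p%:E)[EFin \o val x]%E = 0%E
    by rewrite -[LHS]fineK ?lp_fin_num//; congr EFin; exact: x0.
  rewrite Lnorm_counting// => /poweR_eq0_eq0.
  have ge0 j : (0 <= `|(EFin \o val x) j| `^ p)%E by exact: poweR_ge0.
  move=> /(_ (nneseries_ge0 _)) H.
  have {}H : (\sum_(0 <= j <oo) `|(EFin \o val x) j| `^ p = 0)%E.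
    by apply: H => j _ _.
  have hle : (\sum_(0 <= j < k.+1) `|(EFin \o val x) j| `^ p <= 0)%E.
    by rewrite -[leRHS]H; apply: nneseries_lim_ge => j _ _; exact: ge0.
  rewrite big_nat_recr//= in hle.
  have : (`|(val x k)%:E| `^ p <= 0)%E.
    by apply: le_trans hle; rewrite leeDr// sume_ge0.
  rewrite abse_EFin poweR_EFin lee_fin => h.
  have /powR_eq0_eq0/eqP : `|val x k| `^ p = 0.
    by apply/eqP; rewrite eq_le h powR_ge0.
  by rewrite normr_eq0 => /eqP.
Qed.

HB.instance Definition _ S := @Lmodule_isNormed.Build R (seqs S)
  (seq_norm S \o val) (@seq_normD S) (@seq_normZ S) (@seq_norm0_eq0 S).

End seq_spaces.
Arguments seq_space R : clear implicits.
Coercion coords : seqs >-> Funclass.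

Section weighted_shift.
Context {R : realType} {S : seq_space R}.
Local Notation X := (seqs S).
Implicit Types (a : nat -> R) (x : X).

(* [insubd 0] makes these total in [a]; for weights bounded above
   (resp. bounded away from 0) the default is never used, see [shiftE]
   and [preE]. *)
Definition shift a (x : X) : X := insubd 0 (fun k => a k * x k.+1).

(* The point (r, x_1 / alpha_1, x_2 / alpha_2, ...) *)
Definition pre a (r : R) (x : X) : X :=
  insubd 0 (fun k => if k is j.+1 then x j / a j else r).

Lemma in_lpP p (p1 : 1 <= p) (x : nat -> R) : in_seq_space (lp_space p1) x <->
  (\sum_(0 <= k <oo) (`|x k| `^ p)%:E < +oo)%E.
Proof.
have p0 : 0 < p by rewrite (lt_le_trans ltr01).
rewrite /= /finite_norm Lnorm_counting//; split.
  move=> /lty_poweRy; apply.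
    by rewrite invr_neq0// gt_eqF.
by move=> h; exact: poweR_lty.
Qed.

Lemma in_seq_spaceM (m x : nat -> R) (M : R) : (forall k, `|m k| <= M) ->
  in_seq_space S x -> in_seq_space S (fun k => m k * x k).
Proof.
move=> mM; have M0 : 0 <= M by apply: le_trans (mM 0%N).
case: S => [/= x0|p p1 /in_lpP xp]; last first.
  apply/in_lpP.
  apply: (@le_lt_trans _ _ (\sum_(0 <= k <oo) (M `^ p)%:E * (`|x k| `^ p)%:E)%E).
    apply: lee_nneseries => [k _ _|k _]; first by rewrite lee_fin powR_ge0.
    rewrite -EFinM lee_fin normrM powRM// ler_wpM2r ?powR_ge0//.
    by rewrite ge0_ler_powR ?nnegrE// (le_trans ler01).
  rewrite nneseriesZl; last by move=> k _; rewrite lee_fin powR_ge0.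
  by rewrite lte_mul_pinfty ?lee_fin ?powR_ge0.
apply: norm_cvg0.
apply: (@squeeze_cvgr _ _ _ _ (cst 0) (fun k => M * `|x k|)).
- by apply: nearW => k /=; rewrite normr_ge0 normrM ler_wpM2r.
- exact: cvg_cst.
- rewrite -[0 in X in _ --> X](mulr0 M); apply: cvgM; first exact: cvg_cst.
  by rewrite -[0 in X in _ --> X](@normr0 _ R); exact: cvg_norm.
Qed.

Lemma in_seq_space_tail (x : nat -> R) :
  in_seq_space S (fun k => x k.+1) <-> in_seq_space S x.
Proof.
case: S => [/=|p p1]; first by rewrite -(cvg_shiftS x).
have ge0 (y : nat -> R) k : (0 <= (`|y k| `^ p)%:E)%E.
  by rewrite lee_fin powR_ge0.
have recl : (\sum_(0 <= k <oo) (`|x k| `^ p)%:E =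
    (`|x 0%N| `^ p)%:E + \sum_(0 <= k <oo) (`|x k.+1| `^ p)%:E)%E.
  rewrite nneseries_recl// -(@nneseries_addn _ (fun k => (`|x k| `^ p)%:E) 1)//.
  by congr (_ + _)%E; apply: eq_eseriesr => k _; rewrite addn1.
split=> /in_lpP h; apply/in_lpP; first by rewrite recl lte_add_pinfty ?ltry.
by apply: le_lt_trans h; rewrite recl leeDr.
Qed.

Lemma shiftE a (c' : R) : (forall k, 0 < a k < c') ->
  forall x k, shift a x k = a k * x k.+1.
Proof.
move=> ha x k; rewrite /coords insubdK// inE/=.
apply: (@in_seq_spaceM _ _ c') => [j|]; last exact/in_seq_space_tail/seqsP.
by have /andP[a0 ac] := ha j; rewrite gtr0_norm// ltW.
Qed.

Lemma preE a (c : R) : 0 < c -> (forall k, c < a k) ->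
  forall r x k, pre a r x k = if k is j.+1 then x j / a j else r.
Proof.
move=> c0 ha r x k; rewrite /coords insubdK// inE/=.
apply/in_seq_space_tail.
rewrite (_ : (fun _ => _) = (fun j => (a j)^-1 * x j)); last first.
  by apply/funext => j; rewrite mulrC.
apply: (@in_seq_spaceM _ _ c^-1) => [j|]; last exact: seqsP.
have a0 := lt_trans c0 (ha j).
by rewrite gtr0_norm ?invr_gt0// lef_pV2 ?posrE// ltW.
Qed.

(* beta_(k+1)^n = alpha_(k+1) ... alpha_(k+n) *)
Definition beta a (k n : nat) : R := \prod_(k <= j < k + n) a j.

Definition dmin a (n : nat) : R := inf (range (fun k => beta a k n)).

Definition kerL a (n : nat) : set X := [set z | iter n (shift a) z = 0].

Definition Espace (n : nat) : set X :=
  [set x : X | forall k, (k < n)%N -> x k = 0].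

Definition holder (alpha : R) : set (X -> R) :=
  [set phi | continuous phi /\
    (ereal_sup [set e | exists x y, x != y /\
       e = (`|phi x - phi y| / `|x - y| `^ alpha)%:E] < +oo)%E].

Definition bounded_above (A : X -> R) := exists M, forall x, A x <= M.

Definition Cb : set (X -> R) :=
  [set phi | continuous phi /\ exists M, forall x, `|phi x| <= M].

Definition variation a (n : nat) (A : X -> R) : \bar R :=
  ereal_sup [set e | exists z x y, [/\ kerL a n z, Espace n x, Espace n y &
    e = (`|A (z + x) - A (z + y)|)%:E]].

Definition summable_variation a : set (X -> R) :=
  [set A | continuous A /\ (\sum_(1 <= n <oo) variation a n A < +oo)%E].

End weighted_shift.
Arguments Cb {R} S.

(* Ker(L) is the line spanned by e_1, so an a priori measure is a Borel
   probability on R. *)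
Definition mu_support {R : realType} (nu : probability (measurableTypeR R) R) :
    set R :=
  [set r | forall U : set R, open U -> U r -> (0 < nu U)%E].

Definition strong_adapted_tails {R : realType} (a : nat -> R)
    (nu : probability (measurableTypeR R) R) :=
  forall eps : R, 0 < eps -> exists kappa : nat -> R,
    [/\ forall n, 0 < kappa n,
        (\sum_(1 <= n <oo) (`|kappa n|)%:E < +oo)%E &
        (\sum_(1 <= n <oo)
           nu (~` `[(- (dmin a n * kappa n))%R, (dmin a n * kappa n)%R]%classic)
         < eps%:E)%E].

Section thermodynamics.
Context {R : realType} {S : seq_space R}.
Variables (a : nat -> R) (nu : probability (measurableTypeR R) R).
Local Notation X := (seqs S).
Local Notation borelX := (g_sigma_algebraType (@open X)).
Implicit Types (A psi phi u : X -> R) (mu : probability borelX R).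

Definition ruelle A phi (x : X) : R :=
  (\int[nu]_r (expR (A (pre a r x)) * phi (pre a r x)))%R.

(* mu' = L_A^* mu *)
Definition dual_ruelle A (mu mu' : {measure set borelX -> \bar R}) :=
  forall phi, Cb S phi ->
    (\int[mu']_x (phi x)%:E = \int[mu]_x (ruelle A phi x)%:E)%E.

(* Ruelle-Perron-Frobenius data: the main eigenvalue lambda_A and an associated
   eigenfunction psi_A. *)
Definition main_eigenpair (alpha : R) A (lambda : R) psi :=
  [/\ 0 < lambda, forall x, 0 < psi x, holder alpha psi /\ Cb S psi &
      forall x, ruelle A psi x = lambda * psi x].

Definition normalized A (lambda : R) psi (x : X) : R :=
  A x + ln (psi x) - ln (psi (shift a x)) - ln lambda.

Definition gibbs_state A lambda psi mu :=
  dual_ruelle (normalized A lambda psi) mu mu.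

Definition invariant mu :=
  forall B : set borelX, measurable B -> mu (shift a @^-1` B) = mu B.

Definition log_ratio u (x : X) : R := ln (ruelle (cst 0) u x / u x).

Definition integral_defined mu (f : X -> R) :=
  (\int[mu]_x ((EFin \o f)^\+ x) < +oo)%E \/
  (\int[mu]_x ((EFin \o f)^\- x) < +oo)%E.

(* For u in C_b with u > 0 the function log (L_0 u / u) may have both its
   positive and its negative part of infinite integral (the library's integral
   would then be -oo), so the infimum ranges over the u for which the integral
   exists. *)
Definition entropy mu : \bar R :=
  ereal_inf [set (\int[mu]_x (log_ratio u x)%:E)%E | u in
    [set u | [/\ Cb S u, forall x, 0 < u x &
                 integral_defined mu (log_ratio u)]]].

(* entropy mu <= 0 (take u = 1) and the integral of A is < +oo when A is
   bounded above, so the sum is never of the form +oo - oo. *)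
Definition pressure A : \bar R :=
  ereal_sup [set (entropy mu + \int[mu]_x (A x)%:E)%E | mu in invariant].

End thermodynamics.

(* Main.v *)
Require Import Defs.
From HB Require Import structures.
From mathcomp Require Import all_boot all_order all_algebra.
From mathcomp Require Import all_classical all_reals all_analysis.
From mathcomp Require Import measurable_realfun ring lra.

Set Implicit Arguments.
Unset Strict Implicit.
Unset Printing Implicit Defensive.

Import Order.TTheory GRing.Theory Num.Theory.
Import numFieldNormedType.Exports.

Local Open Scope classical_set_scope.
Local Open Scope ring_scope.

(** The function w = e^A psi is a positive element of C_b, because A is bounded
    above, and the eigenvalue equation reads L0 w = lambda w e^(- A), where L0 is the
    Ruelle operator of the zero potential and s is the shift.  So
    log (L0 w / w) = log lambda - A, and w is one of the test functions in the infimum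
    defining the entropy.  This gives h(m) + int A dm <= log lambda for every
    invariant m, whether A is integrable or not.

    It remains to show that for the Gibbs state mu the infimum is attained at w
    ([weight_minimizes]).  The normalized potential is the logarithm of the
    transition density g_w = w / (L0 w o s), so mu is invariant under the dual of the
    Markov operator with density g_w; it follows that mu is s-invariant
    ([gibbs_invariant]).  For another test function u, the Markov operator maps
    the likelihood ratio G = g_u / g_w to 1, whence int G dmu <= 1
    ([weight_ratio_integral]) and int log G dmu <= 0.  On the other hand,
      log G = log (L0 w / w) - log (L0 u / u) + b - b o s
    with b = log (L0 u / L0 w), see [ln_weight_ratio].  Integrating gives
    int log (L0 w / w) dmu <= int log (L0 u / u) dmu.

    The delicate point is integrability: A and log psi may be unbounded below, and
    log u is arbitrary.  It is handled by [coboundary_integral]: if b - b o s is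
    bounded above by an integrable function, then it is integrable with integral 0,
    even when b is not integrable.  The case u = 1 yields the integrability of A
    ([log_ratio_weight_integrable]). *)

(** * Integrals against a probability measure *)

Section probability_integrals.
Context {d : measure_display} {T : measurableType d} {R : realType}.
Variable m : probability T R.

Lemma bounded_integrable (f : T -> R) (M : R) : measurable_fun setT f ->
  (forall x, `|f x| <= M) -> m.-integrable setT (EFin \o f).
Proof.
move=> mf fM; apply: measurable_bounded_integrable => //.
  exact: le_lt_trans (probability_le1 m measurableT) (ltry _).
exists M; split; first exact: num_real.
by move=> N MN x _; exact: le_trans (fM x) (ltW MN).
Qed.

Lemma integral_gt0 (f : T -> R) : measurable_fun setT f ->
  (forall x, 0 < f x) -> (0 < \int[m]_x (f x)%:E)%E.
Proof.
move=> mf f0; rewrite lt_neqAle integral_ge0 ?andbT; last first.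
  by move=> x _; rewrite lee_fin ltW.
apply/negP => /eqP/esym I0.
have mf' := (measurable_EFinP _ _).2 mf.
have : (\int[m]_x `|(f x)%:E| = 0)%E.
  by rewrite -[RHS]I0; apply: eq_integral => x _; rewrite gee0_abs// lee_fin ltW.
move=> /(ae_eq_integral_abs m measurableT mf') [N [mN N0 sub]].
have : m N = 1%E.
  rewrite -(probability_setT m); congr (m _); apply/seteqP; split => // x _.
  by apply: sub => /= /(_ Logic.I) []/eqP; rewrite gt_eqF.
by rewrite N0 => /eqP; rewrite lt_eqF.
Qed.

Lemma funeneg_integral_lty (f : T -> R) (K : R) : measurable_fun setT f ->
  (forall x, K <= f x) -> (\int[m]_x ((EFin \o f)^\- x) < +oo)%E.
Proof.
move=> mf Kf; pose q x := Num.max (- f x) 0.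
have : m.-integrable setT (EFin \o q).
  apply: (@bounded_integrable _ `|K|) => [|x].
    by apply: measurable_maxr => //; exact: measurableT_comp.
  rewrite ger0_norm ?le_max ?lexx ?orbT// ge_max normr_ge0 andbT.
  by rewrite -normrN; apply: le_trans (ler_norm _); rewrite lerN2.
move=> /integrableP[_]; apply: le_lt_trans.
rewrite le_eqVlt; apply/orP; left; apply/eqP/eq_integral => x _.
by rewrite gee0_abs/= ?lee_fin ?le_max ?lexx ?orbT// funenegE/= EFin_max.
Qed.

Lemma integral_bounded_above (f : T -> R) (K : R) : measurable_fun setT f ->
  (forall x, f x <= K) -> ~ m.-integrable setT (EFin \o f) ->
  (\int[m]_x (f x)%:E = -oo)%E.
Proof.
move=> mf fK ni; have mfE := (measurable_EFinP _ _).2 mf.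
have nfin : (\int[m]_x (f x)%:E)%E \isn't a fin_num.
  apply/negP; rewrite -integral_fin_num_abs// => fin; apply: ni.
  exact/integrableP.
have pos : (\int[m]_x ((EFin \o f)^\+ x) < +oo)%E.
  rewrite -funenegN; apply: (@funeneg_integral_lty (fun x => - f x) (- K)).
    exact: measurableT_comp.
  by move=> x; rewrite lerN2.
have ltoo : (\int[m]_x (f x)%:E < +oo)%E.
  rewrite integralE; apply: le_lt_trans pos.
  by rewrite geeDl// oppe_le0 integral_ge0.
by apply/eqP; move: nfin; rewrite fin_numE (lt_eqF ltoo) andbT negbK.
Qed.

End probability_integrals.

(** * Coboundaries of an invariant measure *)

Section coboundary.
Context {d : measure_display} {T : measurableType d} {R : realType}.
Variables (m : probability T R) (s : T -> T).
Hypothesis ms : measurable_fun setT s.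
Hypothesis sm : forall B, measurable B -> m (s @^-1` B) = m B.

Lemma integral_invariant (f : T -> R) : measurable_fun setT f ->
  m.-integrable setT (EFin \o f \o s) ->
  (\int[m]_x (f (s x))%:E = \int[m]_x (f x)%:E)%E.
Proof.
move=> mf fi; have mf' := (measurable_EFinP _ _).2 mf.
have := @integral_pushforward _ _ _ _ _ s ms m setT (EFin \o f) mf' fi measurableT.
rewrite preimage_setT => <-.
apply: eq_measure_integral => B mB _.
exact: (sm mB).
Qed.

Definition clamp (n : nat) (r : R) : R := Num.max (- n%:R) (Num.min r n%:R).

Lemma clamp_le n r : `|clamp n r| <= n%:R.
Proof.
rewrite /clamp; have n0 : 0 <= n%:R :> R by [].
by rewrite ler_norml le_max lexx /= ge_max ge_min lexx orbT andbT; lra.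
Qed.

Lemma clampB_le n r t (u : R) : 0 <= u -> r - t <= u -> clamp n r - clamp n t <= u.
Proof.
move=> u0 rtu; rewrite /clamp; have n0 : 0 <= n%:R :> R by [].
by case: (leP r n%:R) => ?; case: (leP t n%:R) => ?;
  repeat match goal with |- context [Num.max ?x ?y] => case: (leP x y) => ? end;
  lra.
Qed.

Lemma clamp_cvg r : clamp n r @[n --> \oo] --> r.
Proof.
apply: cvg_near_cst; near=> n.
have : `|r| <= n%:R by near: n; exact: nbhs_infty_ger.
rewrite ler_norml /clamp => /andP[nr rn].
by rewrite (min_idPl rn) (max_idPr nr).
Unshelve. all: by end_near. Qed.

Lemma measurable_clamp n (b : T -> R) : measurable_fun setT b ->
  measurable_fun setT (clamp n \o b).
Proof.
move=> mb; apply: measurable_maxr => //.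
exact: measurable_minr.
Qed.

(** Truncating b makes both terms of the coboundary bounded, so their integrals
    cancel by invariance.  Truncation does not increase differences beyond their
    positive part, hence |f| minus the truncated coboundary is nonnegative and
    Fatou's lemma bounds the integral of |f| minus the coboundary by that of |f|. *)
Lemma coboundary_integral_ge0 (b f : T -> R) : measurable_fun setT b ->
  m.-integrable setT (EFin \o f) -> (forall x, b x - b (s x) <= f x) ->
  m.-integrable setT (fun x => (b x - b (s x))%:E) /\
  (0 <= \int[m]_x (b x - b (s x))%:E)%E.
Proof.
move=> mb fi bf.
have mf : measurable_fun setT f by exact/measurable_EFinP/(measurable_int m).
pose g n x := `|f x| - (clamp n (b x) - clamp n (b (s x))).
have mbs : measurable_fun setT (b \o s) by exact: measurableT_comp.
have ci n : m.-integrable setT (EFin \o (clamp n \o b)).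
  by apply: (@bounded_integrable _ _ _ m _ n%:R) => [|x];
    [exact: measurable_clamp|exact: clamp_le].
have csi n : m.-integrable setT (EFin \o (clamp n \o (b \o s))).
  by apply: (@bounded_integrable _ _ _ m _ n%:R) => [|x];
    [exact: measurable_clamp|exact: clamp_le].
have ai : m.-integrable setT (EFin \o (Num.norm \o f)) by exact: integrable_norm.
have gi n : (\int[m]_x (g n x)%:E = \int[m]_x `|f x|%:E)%E.
  under eq_integral do rewrite /g !EFinB.
  rewrite (integralB measurableT ai (integrableB measurableT (ci n) (csi n))).
  rewrite (integralB measurableT (ci n) (csi n)).
  rewrite (@integral_invariant (clamp n \o b) (measurable_clamp _ mb) (csi n)).
  by rewrite subee ?sube0//; exact: (integrable_fin_num measurableT (ci n)).
have mg n : measurable_fun setT (EFin \o g n).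
  apply/measurable_EFinP; apply: measurable_funB.
    exact: measurableT_comp.
  by apply: measurable_funB; exact: measurable_clamp.
have g0 n x : setT x -> (0 <= (EFin \o g n) x)%E.
  move=> _; rewrite lee_fin subr_ge0; apply: clampB_le => //.
  exact: le_trans (bf x) (ler_norm _).
have := fatou m measurableT mg g0.
have -> : (fun x => limn_einf ((fun n => (EFin \o g n) x))) =
    (fun x => (`|f x| - (b x - b (s x)))%:E).
  apply/funext => x; apply: (cvg_limn_einf_sup _).1.
  apply: cvg_EFin; first exact: nearW.
  by apply: cvgB; [exact: cvg_cst|apply: cvgB; exact: clamp_cvg].
have -> : (fun n => \int[m]_x (EFin \o g n) x)%E = cst (\int[m]_x `|f x|%:E)%E.
  by apply/funext => n; exact: gi.
rewrite (cvg_limn_einf_sup (cvg_cst _)).1 => le.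
have mh : measurable_fun setT (fun x => `|f x| - (b x - b (s x))).
  apply: measurable_funB; first exact: measurableT_comp.
  exact: measurable_funB.
have ifin : (\int[m]_x `|f x|%:E)%E \is a fin_num by exact: integrable_fin_num.
have hi : m.-integrable setT (fun x => (`|f x| - (b x - b (s x)))%:E).
  apply/integrableP; split; first exact/measurable_EFinP.
  apply: le_lt_trans (le_trans _ le) _; last by rewrite ltey_eq ifin.
  rewrite le_eqVlt; apply/orP; left; apply/eqP/eq_integral => x _.
  by rewrite gee0_abs// lee_fin subr_ge0; exact: le_trans (bf x) (ler_norm _).
have E : (fun x => (b x - b (s x))%:E) =
    (fun x => `|f x|%:E - (`|f x| - (b x - b (s x)))%:E)%E.
  by apply/funext => x; rewrite -EFinB; congr EFin; lra.
split; first by rewrite E; exact: (integrableB measurableT ai hi).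
rewrite E (integralB measurableT ai hi) sube_ge0//.
by rewrite integrable_fin_num.
Qed.

(** A one-sided integrable bound is enough for the coboundary of a function b that
    need not be integrable itself: once the coboundary is known to be integrable, it
    bounds the coboundary of - b, and the inequality holds in both directions. *)
Lemma coboundary_integral (b f : T -> R) : measurable_fun setT b ->
  m.-integrable setT (EFin \o f) -> (forall x, b x - b (s x) <= f x) ->
  m.-integrable setT (fun x => (b x - b (s x))%:E) /\
  (\int[m]_x (b x - b (s x))%:E = 0)%E.
Proof.
move=> mb fi bf; have [ci c0] := coboundary_integral_ge0 mb fi bf.
split=> //; apply/eqP; rewrite eq_le c0 andbT.
have [||x|_] := @coboundary_integral_ge0 (\- b) (fun x => `|b x - b (s x)|).
- exact: measurableT_comp.
- exact: (@integrable_norm _ _ _ m setT (fun x => b x - b (s x)) ci).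
- by rewrite /= -opprD -normrN ler_norm.
under eq_integral => x _.
  rewrite (_ : - b x - - b (s x) = - (b x - b (s x)))%R; last by ring.
  rewrite EFinN.
  over.
by rewrite integralN ?oppe_ge0// integrable_add_def.
Qed.

End coboundary.

(** * Continuity in normed spaces *)

Section continuity.
Context {R : realType}.

Lemma lipschitz_continuous (Y Z : normedModType R) (f : Y -> Z) (C : R) :
  (forall x y, `|f x - f y| <= C * `|x - y|) -> continuous f.
Proof.
move=> fC x; apply/cvgrPdist_le => e e0.
have C0 : 0 < `|C| + 1 by rewrite ltr_wpDl.
near=> y; apply: le_trans (fC x y) _.
apply: (@le_trans _ _ ((`|C| + 1) * `|x - y|)).
  (* |C| + 1 stands for C, which may fail to be positive *)
  by rewrite ler_wpM2r// (le_trans (ler_norm C))// lerDl.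
rewrite mulrC -ler_pdivlMr//.
near: y; apply: cvgr_dist_le => //; exact: divr_gt0.
Unshelve. all: by end_near. Qed.

(** Dominated convergence is a statement on sequences; this converts it into
    continuity of integrals depending on a parameter. *)
Lemma sequential_continuity (Y : normedModType R) (f : Y -> R) (x : Y) :
  (forall y : nat -> Y, y n @[n --> \oo] --> x -> f (y n) @[n --> \oo] --> f x) ->
  {for x, continuous f}.
Proof.
move=> fseq; apply/cvgrPdist_lt => e e0; apply: contrapT => nfe.
have H n : exists y, `|x - y| < n.+1%:R^-1 /\ e <= `|f x - f y|.
  apply: contrapT => /forallNP H; apply: nfe.
  have : \forall y \near x, `|x - y| < n.+1%:R^-1.
    by apply: cvgr_dist_lt; [exact: cvg_id|rewrite invr_gt0].
  apply: filterS => y xy; rewrite ltNge; apply/negP => efy.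
  exact: (H y).
have [y /all_and2[xy efy]] := choice H.
have /cvgrPdist_lt/(_ e e0)[N _ /(_ N (leqnn N))/=] : f (y n) @[n --> \oo] --> f x.
  apply: fseq; apply/cvgrPdist_lt => r r0; near=> n.
  apply: lt_trans (xy n) _; near: n.
  exact: near_infty_natSinv_lt (PosNum r0).
by rewrite ltNge efy.
Unshelve. all: by end_near. Qed.

End continuity.

(** * Borel measures on a normed space *)

Section borel.
Context {R : realType}.
Local Notation borel X := (g_sigma_algebraType (@open X)).

Lemma continuous_borel_fun (X Y : normedModType R) (s : X -> Y) :
  continuous s -> measurable_fun [set: borel X] (s : borel X -> borel Y).
Proof.
move=> /continuousP cs.
apply: (@measurability _ _ (borel X) (borel Y) setT s (@open Y) erefl).
move=> _ [U oU <-].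
by rewrite setTI; apply: sub_sigma_algebra; exact: cs.
Qed.

Lemma continuous_borel (X : normedModType R) (f : X -> R) :
  continuous f -> measurable_fun [set: borel X] f.
Proof.
move=> /continuousP cf.
apply: (@measurability _ _ (borel X) R setT f _ (RGenOInfty.measurableE R)).
move=> _ [_ [r ->] <-]; rewrite setTI; apply: sub_sigma_algebra.
by apply: cf; exact: itv_open_ends_open.
Qed.

(** Take the distance to the complement of U, cut off at 1. *)
Lemma open_distance (X : normedModType R) (U : set X) : open U ->
  exists delta : X -> R, [/\ continuous delta, forall x, 0 <= delta x <= 1,
    forall x, U x -> 0 < delta x & forall x, ~ U x -> delta x = 0].
Proof.
move=> oU; have [UT|/set0P[a0 Ua0]] := eqVneq (~` U) set0.
  exists (cst 1); split => [x|x|x _|x nUx]; rewrite /= ?ler01 ?lexx//.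
    exact: cvg_cst.
  by have : (~` U) x by []; rewrite UT.
pose D x := edist_inf (~` U) x.
have D0 x : (0 <= D x)%E by exact: edist_inf_ge0.
have Dfin x : D x \is a fin_num.
  rewrite ge0_fin_numE//; apply: le_lt_trans.
    by apply: ereal_inf_lbound; exists a0.
  rewrite -ge0_fin_numE ?edist_ge0//; apply/edist_finP => /=.
  exists (`|x - a0| + 1); first by rewrite ltr_pwDr.
  by rewrite -ball_normE/= ltrDl.
have cD : continuous (fine \o D : X -> R^o).
  by move=> x; apply: fine_cvg; rewrite fineK//; exact: edist_inf_continuous.
exists ((cst 1 : X -> R^o) \min (fine \o D)); split.
- by move=> x; apply: (@continuous_min R X (cst 1) (fine \o D) x); [exact: cvg_cst|exact: cD].
- by move=> x /=; rewrite le_min ler01 fine_ge0//= ge_min lexx.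
- move=> x Ux; rewrite /= lt_min ltr01 fine_gt0// lt_neqAle D0 andbT ltey_eq Dfin andbT.
  apply/negP => /eqP/esym D00.
  have /nbhs_ballP[e /= e0 xeU] : nbhs x U by exact: open_nbhs_nbhs.
  have : (e%:E <= D x)%E.
    apply: le_ereal_inf_tmp => _ [y nUy <-]; rewrite leNgt; apply/negP => /edist_lt_ball.
    by move=> /xeU.
  by rewrite D00 lee_fin leNgt e0.
- by move=> x nUx; rewrite /= /D edist_inf0// min_r.
Qed.

(** Open sets generate the Borel sets and are stable under intersection.  If delta
    is the truncated distance to the complement of U, the bounded continuous
    functions 1 - (1 - delta) ^ n converge to the indicator of U. *)
Lemma eq_measure_bounded_continuous (X : normedModType R)
    (m1 m2 : {measure set (borel X) -> \bar R}) :
  (m1 setT < +oo)%E -> (m2 setT < +oo)%E ->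
  (forall f : X -> R, continuous f -> (forall x, 0 <= f x <= 1)%R ->
    \int[m1]_x (f x)%:E = \int[m2]_x (f x)%:E)%E ->
  forall B, measurable B -> m1 B = m2 B.
Proof.
move=> m1oo m2oo H B; apply: (@measure_unique _ R (borel X) (@open X) (fun=> setT) erefl).
- by move=> ? ?; exact: openI.
- by move=> _; exact: openT.
- by rewrite bigcup_const.
- move=> U oU; have [delta [cd d01 dU dnU]] := open_distance oU.
  pose f n x := 1 - (1 - delta x) ^+ n.
  have cf n : continuous (f n).
    move=> x; apply: cvgB; first exact: cvg_cst.
    apply: (@continuous_comp X R R (fun x => 1 - delta x) (fun y => y ^+ n) x).
      by apply: cvgB; [exact: cvg_cst|exact: cd].
    exact: exprn_continuous.
  have f01 n x : 0 <= f n x <= 1.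
    have /andP[d0 d1] := d01 x.
    by rewrite subr_ge0 exprn_ile1 ?subr_ge0//= ?gerBl ?exprn_ge0 ?subr_ge0//; lra.
  have lim (m : {measure set (borel X) -> \bar R}) : (m setT < +oo)%E ->
      (\int[m]_x (f n x)%:E)%E @[n --> \oo] --> m U.
    move=> moo; rewrite -[U in m U]setIT -integral_indic//; last exact: sub_sigma_algebra.
    apply: (@dominated_cvg _ _ _ m setT measurableT _ _ (cst 1%E)) => //.
    + by move=> n; apply/measurable_EFinP; exact: continuous_borel.
    + move=> x _; apply: cvg_EFin; first exact: nearW.
      rewrite indicE; case: (pselect (U x)) => Ux.
        rewrite mem_set//= -[1%:R in X in _ --> X]subr0.
        apply: cvgB; first exact: cvg_cst.
        apply: cvg_expr; have := dU _ Ux; have /andP[? ?] := d01 x.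
        by rewrite ger0_norm; lra.
      rewrite memNset//=; apply: cvg_near_cst; apply: nearW => n.
      by rewrite /f dnU// subr0 /= expr1n subrr.
    + apply/integrableP; split; first exact: measurable_cst.
      under eq_integral do rewrite /= normr1.
      by rewrite integral_cst// mul1e.
    + move=> n x _ /=; rewrite lee_fin; have /andP[? ?] := f01 n x.
      by rewrite ger0_norm.
  have := lim m1 m1oo; have -> :
      (fun n => \int[m1]_x (f n x)%:E)%E = (fun n => \int[m2]_x (f n x)%:E)%E.
    by apply/funext => n; apply: H.
  by move=> h1; apply: (cvg_unique _ h1 (lim m2 m2oo)).
- by [].
Qed.

End borel.

(** * The weighted shift and its inverse branches *)

Section weighted_shift.
Context {R : realType} {S : seq_space R}.
Local Notation X := (seqs S).

Lemma coordsP (x y : X) : (forall k, x k = y k) -> x = y.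
Proof. by move=> xy; apply/val_inj/funext. Qed.

Lemma coordsB (x y : X) k : coords (x - y) k = x k - y k.
Proof. by rewrite /coords raddfB. Qed.

Lemma coordsD (x y : X) k : coords (x + y) k = x k + y k.
Proof. by rewrite /coords raddfD. Qed.

Lemma coordsZ l (x : X) k : coords (l *: x) k = l * x k.
Proof. by []. Qed.

Lemma le_seq_norm (x y : X) : (forall k, `|x k| <= `|y k|) -> `|x| <= `|y|.
Proof.
rewrite -![`|_ : X|]/(seq_norm _ _); case: S x y => [|p p1] x y xy /=.
  apply: ge_sup; first by exists `|x 0%N|, 0%N.
  move=> _ [k _ <-]; apply: le_trans (xy k) _.
  by apply: ub_le_sup; [exact: c0_has_sup (seqsP y)|exists k].
have p0 : 0 < p by exact: lt_le_trans ltr01 p1.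
rewrite fine_le ?lp_fin_num// !Lnorm_counting//.
have ge0 (z : nat -> R) : (0 <= \sum_(0 <= k <oo) `|(EFin \o z) k| `^ p)%E.
  by apply: nneseries_ge0 => *; exact: poweR_ge0.
apply: gt0_ler_poweR; rewrite ?invr_ge0 ?(ltW p0)//=.
- by rewrite in_itv/= leey ge0.
- by rewrite in_itv/= leey ge0.
apply: lee_nneseries => [k _ _|k _]; first by rewrite lee_fin powR_ge0.
by rewrite /= lee_fin ge0_ler_powR ?nnegrE ?(ltW p0)//; exact: xy.
Qed.

(** Both norms ignore a leading zero.  With [le_seq_norm], this reduces the shift
    and its inverse branches to coordinatewise multiplications. *)
Lemma seq_norm_cons (x y : X) : (forall k, x k = y k.+1) -> y 0%N = 0 ->
  `|x| = `|y|.
Proof.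
rewrite -![`|_ : X|]/(seq_norm _ _); case: S x y => [|p p1] x y xy y0 /=.
  apply/eqP; rewrite eq_le; apply/andP; split.
    apply: ge_sup; first by exists `|x 0%N|, 0%N.
    move=> _ [k _ <-]; rewrite -[val x k]/(x k) xy.
    by apply: ub_le_sup; [exact: c0_has_sup (seqsP y)|exists k.+1].
  apply: ge_sup; first by exists `|y 0%N|, 0%N.
  move=> _ [[|k] _ <-]; rewrite -[val y _]/(y _).
    by rewrite y0 normr0; exact: (seq_norm_ge0 x).
  by rewrite -xy; apply: ub_le_sup; [exact: c0_has_sup (seqsP x)|exists k].
have p0 : 0 < p by exact: lt_le_trans ltr01 p1.
rewrite !Lnorm_counting//; congr (fine (_ `^ _)%E).
have ge0 k : (0 <= (`|val y k| `^ p)%:E)%E by rewrite lee_fin powR_ge0.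
rewrite [RHS]nneseries_recl//= -[val y 0%N]/(y 0%N) y0 normr0 powR0 ?gt_eqF// add0e.
rewrite -(@nneseries_addn _ (fun k => (`|val y k| `^ p)%:E) 1)//.
by apply: eq_eseriesr => k _; rewrite addn1 -[val x k]/(x k) xy.
Qed.

Variables (c c' : R) (a : nat -> R).
Hypotheses (c_gt0 : 0 < c) (a_bounds : forall k, c < a k < c').

Let a_gt0 k : 0 < a k.
Proof. by have /andP[ca _] := a_bounds k; exact: lt_trans ca. Qed.

Let shiftEa (x : X) k : Defs.shift a x k = a k * x k.+1.
Proof.
by rewrite (@shiftE _ _ _ c')// => j; rewrite a_gt0; have /andP[_ ->] := a_bounds j.
Qed.

Let preEa r (x : X) k : pre a r x k = if k is j.+1 then x j / a j else r.
Proof. by rewrite (preE c_gt0)// => j; have /andP[] := a_bounds j. Qed.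

Let shift1E (x : X) k : Defs.shift (cst 1) x k = x k.+1.
Proof. by rewrite (@shiftE _ _ _ 2) ?mul1r// => j; rewrite /= ltr01 ltr1n. Qed.

Let pre1E r (x : X) k : pre (cst 1) r x k = if k is j.+1 then x j else r.
Proof.
rewrite (@preE _ _ _ 2^-1) ?invr_gt0//; first by case: k => // j; rewrite divr1.
by move=> j; rewrite /= invf_lt1 ?ltr1n.
Qed.

Lemma shift_pre r (x : X) : Defs.shift a (pre a r x) = x.
Proof.
by apply: coordsP => k; rewrite shiftEa preEa mulrC divfK// gt_eqF.
Qed.

Lemma shift_continuous : continuous (Defs.shift a : X -> X).
Proof.
apply: (@lipschitz_continuous _ _ _ _ c') => x y.
pose z := Defs.shift a x - Defs.shift a y.
(* prepending 0 to z aligns its coordinates with those of c' *: (x - y) *)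
rewrite -/z (@seq_norm_cons z (pre (cst 1) 0 z)); last 2 first.
- by move=> k; rewrite pre1E.
- by rewrite pre1E.
have c'0 : 0 < c' by have /andP[_] := a_bounds 0%N; exact: lt_trans.
rewrite -[c' in leRHS]gtr0_norm// -normrZ; apply: le_seq_norm => -[|k].
  by rewrite pre1E normr0.
rewrite pre1E coordsZ coordsB /z coordsB !shiftEa -mulrBr !normrM ler_wpM2r//.
by rewrite !gtr0_norm// ltW//; have /andP[] := a_bounds k.
Qed.

Lemma pre_continuous r : continuous (pre a r : X -> X).
Proof.
apply: (@lipschitz_continuous _ _ _ _ c^-1) => x y.
pose z := pre a r x - pre a r y.
(* z starts with 0, and its tail is dominated by c^-1 *: (x - y) *)
rewrite -/z -(@seq_norm_cons (Defs.shift (cst 1) z) z); last 2 first.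
- by move=> k; rewrite shift1E.
- by rewrite /z coordsB !preEa subrr.
rewrite -[c^-1 in leRHS]gtr0_norm ?invr_gt0// -normrZ; apply: le_seq_norm => k.
rewrite shift1E coordsZ coordsB /z coordsB !preEa -mulrBl mulrC !normrM ler_wpM2r//.
rewrite !gtr0_norm ?invr_gt0// lef_pV2 ?posrE//.
by have /andP[/ltW] := a_bounds k.
Qed.

Lemma pre_continuous_head (x : X) : continuous (fun r : R => pre a r x).
Proof.
(* the branch is affine in its first coordinate: r e_1 + (0, x_1 / a_1, ...) *)
have -> : (fun r => pre a r x) = (fun r => r *: pre a 1 (0 : X) + pre a 0 x).
  apply/funext => r; apply: coordsP => -[|k]; rewrite coordsD coordsZ !preEa.
    by rewrite mulr1 addr0.
  by rewrite [coords 0 k]/(0 : R) mul0r mulr0 add0r.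
move=> r; apply: cvgD; last exact: cvg_cst.
by apply: cvgZr_tmp; exact: cvg_id.
Qed.

End weighted_shift.

(** * The transfer operator with zero potential *)

Section ruelle.
Context {R : realType} {S : seq_space R}.
Local Notation X := (seqs S).
Local Notation borelX := (g_sigma_algebraType (@open X)).
Variables (c c' : R) (a : nat -> R) (nu : probability (measurableTypeR R) R).
Hypotheses (c_gt0 : 0 < c) (a_bounds : forall k, c < a k < c').
Implicit Types (u w : X -> R).

Local Notation L0 := (ruelle a nu (cst 0)).
Local Notation s := (Defs.shift a).

Lemma ruelle0E u x : L0 u x = \int[nu]_r u (pre a r x).
Proof. by apply: eq_Rintegral => r _; rewrite expR0 mul1r. Qed.

Lemma continuous_pre_measurable u x : continuous u ->
  measurable_fun setT (fun r : R => u (pre a r x)).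
Proof.
move=> cu; apply: continuous_measurable_fun => r.
apply: continuous_comp; last exact: cu.
exact: (pre_continuous_head c_gt0 a_bounds).
Qed.

Lemma pre_integrable u x : Cb S u ->
  nu.-integrable setT (fun r => (u (pre a r x))%:E).
Proof.
move=> [cu [M uM]]; apply: (@bounded_integrable _ _ _ nu _ M).
  exact: continuous_pre_measurable.
by move=> r; exact: uM.
Qed.

Lemma ruelle0K u x : Cb S u -> ((L0 u x)%:E = \int[nu]_r (u (pre a r x))%:E)%E.
Proof.
move=> Cu; rewrite ruelle0E fineK//.
by apply: integrable_fin_num => //; exact: pre_integrable.
Qed.

Lemma ruelle0_gt0 u x : Cb S u -> (forall y, 0 < u y) -> 0 < L0 u x.
Proof.
move=> Cu u0; rewrite -lte_fin ruelle0K//; apply: integral_gt0 => //.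
by apply: continuous_pre_measurable; case: Cu.
Qed.

(** The operator has the Feller property: the inverse branches depend continuously
    on the base point and u is bounded, so dominated convergence applies. *)
Lemma ruelle0_continuous u : Cb S u -> continuous (L0 u).
Proof.
move=> Cu x; apply: sequential_continuity => y yx.
have [cu [M uM]] := Cu.
apply: fine_cvg; rewrite ruelle0K//.
have E n : (\int[nu]_r (expR (cst 0 (pre a r (y n))) * u (pre a r (y n)))%:E =
   \int[nu]_r (u (pre a r (y n)))%:E)%E.
  by apply: eq_integral => r _; rewrite expR0 mul1r.
under eq_fun do rewrite E.
apply: (@dominated_cvg _ _ _ nu setT measurableT _ _ (cst M%:E)) => //.
- by move=> n; apply/measurable_EFinP; exact: continuous_pre_measurable.
- move=> r _; apply: cvg_EFin; first exact: nearW.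
  apply: (@cvg_comp _ _ _ y (fun z => u (pre a r z)) _ _ _ yx).
  apply: continuous_comp; last exact: cu.
  exact: (pre_continuous c_gt0 a_bounds).
- exact: (@finite_measure_integrable_cst _ _ R nu setT M).
- by move=> n r _ /=; rewrite lee_fin.
Qed.

Lemma CbM u w : Cb S u -> Cb S w -> Cb S (fun x => u x * w x).
Proof.
move=> [cu [M uM]] [cw [N wN]]; split.
  by move=> x; exact: (cvgM (cu x) (cw x)).
by exists (M * N) => x; rewrite normrM ler_pM.
Qed.

End ruelle.

(** * Entropy minimisation by a Gibbs weight *)

(** A weight w > 0 in C_b determines the transition densities w / (L0 w o s) along
    the inverse branches of the shift s.  Below mu is invariant under the dual of the
    resulting Markov operator.  For w = e^A psi this operator is the one of the
    normalized potential and log (L0 w / w) = log lambda - A. *)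

Section equilibrium.
Context {R : realType} {S : seq_space R}.
Local Notation X := (seqs S).
Local Notation borelX := (g_sigma_algebraType (@open X)).
Variables (c c' : R) (a : nat -> R) (nu : probability (measurableTypeR R) R).
Hypotheses (c_gt0 : 0 < c) (a_bounds : forall k, c < a k < c').
Local Notation L0 := (ruelle a nu (cst 0)).
Local Notation s := (Defs.shift a).
Variables (w : X -> R) (mu : probability borelX R).
Hypotheses (Cw : Cb S w) (w_gt0 : forall x, 0 < w x).
Hypothesis gibbs_w : (forall phi, Cb S phi ->
  \int[mu]_x (phi x)%:E =
  \int[mu]_x (L0 (fun y => w y * phi y)%R x / L0 w x)%:E)%E.

Let cs : continuous (s : X -> X) := @shift_continuous _ _ _ _ _ c_gt0 a_bounds.

Let ms : measurable_fun setT (s : borelX -> borelX) := continuous_borel_fun cs.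

Let L0w_gt0 x : 0 < L0 w x.
Proof. exact: (ruelle0_gt0 nu c_gt0 a_bounds). Qed.

(** The function f o s is constant along the inverse branches, so the Markov
    operator maps it to f; bounded continuous f determine the measure. *)
Lemma gibbs_invariant : Defs.invariant a mu.
Proof.
have muT (m : {measure set borelX -> \bar R}) : m setT = 1%E -> (m setT < +oo)%E.
  by move=> ->; rewrite ltry.
pose m' := measure_function_pushforward__canonical__measure_function_Measure mu ms.
move=> B mB; have H := @eq_measure_bounded_continuous R X m' mu.
apply: (H _ _ _ B mB) => {B mB H}.
- by apply: muT; rewrite -(probability_setT mu).
- by apply: muT; rewrite -(probability_setT mu).
move=> f cf f01.
have Cfs : Cb S (f \o s).
  split; first by move=> x; apply: continuous_comp; [exact: cs|exact: cf].
  by exists 1 => x /=; have /andP[f0 f1] := f01 (s x); rewrite ger0_norm.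
transitivity (\int[mu]_x ((f \o s) x)%:E)%E.
  have mf : measurable_fun setT (EFin \o f : borelX -> _).
    by apply/measurable_EFinP; exact: continuous_borel.
  rewrite (ge0_integral_pushforward ms mu measurableT mf) ?preimage_setT//.
  by move=> x _; rewrite lee_fin; have /andP[] := f01 x.
rewrite (gibbs_w Cfs); apply: eq_integral => x _; congr EFin.
rewrite !ruelle0E.
under eq_Rintegral do rewrite /= (shift_pre c_gt0 a_bounds).
rewrite RintegralZr//; last exact: (pre_integrable nu c_gt0 a_bounds).
by rewrite mulrAC -ruelle0E divff ?mul1r// gt_eqF.
Qed.

(** The quotient of the transition densities of u and w: a likelihood ratio. *)
Definition weight_ratio (u : X -> R) (x : X) : R :=
  (u x / L0 u (s x)) / (w x / L0 w (s x)).

(** The Markov operator of w maps the likelihood ratio to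
    the function L0 (u / L0 u o s) = 1.  The ratio may be unbounded, while duality is
    only assumed for C_b; so it is truncated and monotone convergence gives one
    inequality, which is all that is used. *)
Lemma weight_ratio_integral (u : X -> R) : Cb S u -> (forall x, 0 < u x) ->
  mu.-integrable setT (EFin \o weight_ratio u) /\
  (\int[mu]_x (weight_ratio u x)%:E <= 1)%E.
Proof.
move=> Cu u0.
have L0u_gt0 y : 0 < L0 u y by exact: (ruelle0_gt0 nu c_gt0 a_bounds).
set G := weight_ratio u.
have G0 x : 0 <= G x by rewrite ltW// /G /weight_ratio !divr_gt0.
have cL0s v : Cb S v -> (forall x, 0 < v x) -> continuous (fun x => v x / L0 v (s x)).
  move=> Cv v0 x; have [cv _] := Cv.
  have cL : {for x, continuous (L0 v \o s)}.
    by apply: continuous_comp; [exact: cs|exact: (ruelle0_continuous c_gt0 a_bounds)].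
  apply: (cvgM (cv x)); apply: (cvgV _ cL).
  by rewrite /= gt_eqF// (ruelle0_gt0 nu c_gt0 a_bounds).
have cG : continuous G.
  move=> x; apply: (cvgM (cL0s u Cu u0 x)); apply: (cvgV _ (cL0s w Cw w_gt0 x)).
  by rewrite gt_eqF// divr_gt0.
pose phi (n : nat) : X -> R := (G : X -> R^o) \min cst n%:R.
have phi0 n x : 0 <= phi n x by rewrite le_min G0/=.
have phiG n x : phi n x <= G x by rewrite ge_min lexx.
have Cphi n : Cb S (phi n).
  split=> [x|].
    have h2 : {for x, continuous (cst n%:R : X -> R^o)} := @cst_continuous _ _ _ x.
    exact: (@continuous_min R X _ _ x (cG x) h2).
  by exists n%:R => x; rewrite ger0_norm// ge_min lexx orbT.
have mphi n : measurable_fun setT (EFin \o phi n : borelX -> _).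
  by apply/measurable_EFinP; apply: continuous_borel; case: (Cphi n).
have le1 n : (\int[mu]_x (phi n x)%:E <= 1)%E.
  rewrite (gibbs_w (Cphi n)) -[leRHS](probability_setT mu) -[leRHS]mul1e -integral_cst//.
  apply: ge0_le_integral => //.
  - move=> x _; rewrite lee_fin divr_ge0 ?(ltW (L0w_gt0 x))// ruelle0E.
    by apply: Rintegral_ge0 => r _; rewrite mulr_ge0// ltW.
  - apply/measurable_EFinP; apply: continuous_borel => x.
    have c1 : {for x, continuous (L0 (fun y => w y * phi n y))}.
      exact: (ruelle0_continuous c_gt0 a_bounds (CbM Cw (Cphi n))).
    have c2 : {for x, continuous (L0 w)} by exact: (ruelle0_continuous c_gt0 a_bounds).
    by apply: (cvgM c1); apply: (cvgV _ c2); rewrite gt_eqF.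
  - move=> x _; rewrite lee_fin ler_pdivrMr// mul1r.
    rewrite -lee_fin !(ruelle0K nu c_gt0 a_bounds)//; last exact: CbM.
    (* along the branches over x, the product w * G is a constant multiple of u *)
    apply: (@le_trans _ _ (\int[nu]_r (L0 w x / L0 u x * u (pre a r x))%:E)%E).
      apply: le_integral => //.
      + exact: (pre_integrable nu c_gt0 a_bounds _ (CbM Cw (Cphi n))).
      + exact: (integrableZl measurableT _ (pre_integrable nu c_gt0 a_bounds _ Cu)).
      + move=> r _; rewrite lee_fin.
        apply: (le_trans (ler_wpM2l (ltW (w_gt0 _)) (phiG n _))).
        rewrite /G /weight_ratio (shift_pre c_gt0 a_bounds).
        rewrite le_eqVlt; apply/orP; left; apply/eqP; field.
        by rewrite !gt_eqF.
    under eq_integral do rewrite EFinM.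
    rewrite integralZl//; last exact: (pre_integrable nu c_gt0 a_bounds).
    rewrite -!(ruelle0K nu c_gt0 a_bounds)// -EFinM lee_fin.
    by rewrite divfK// gt_eqF.
have := @cvg_monotone_convergence _ _ _ mu setT measurableT (fun n x => (phi n x)%:E) mphi.
have phi0' n x : setT x -> (0 <= (phi n x)%:E)%E by rewrite lee_fin.
have phind x : setT x -> {homo (fun n => (phi n x)%:E) : n m / (n <= m)%N >-> (n <= m)%E}.
  by move=> _ n k nk; rewrite lee_fin le_min2// ler_nat.
move=> /(_ phi0' phind).
have -> : (fun x => limn (fun n => (phi n x)%:E)) = EFin \o G.
  apply/funext => x; apply: cvg_lim => //; apply: cvg_EFin; first exact: nearW.
  apply: cvg_near_cst; near=> n; rewrite /phi /= min_l//.
  by near: n; exact: nbhs_infty_ger.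
move=> cvg.
have G1 : (\int[mu]_x (G x)%:E <= 1)%E.
  rewrite -(cvg_lim _ cvg)//; apply: lime_le; first by apply/cvg_ex; exists (\int[mu]_x (G x)%:E)%E.
  exact: nearW.
split=> //; apply/integrableP; split.
  by apply/measurable_EFinP; exact: continuous_borel.
under eq_integral do rewrite gee0_abs ?lee_fin//.
exact: le_lt_trans G1 (ltry _).
Unshelve. all: by end_near. Qed.

(** The identity behind the variational principle: up to a coboundary, the
    logarithmic likelihood ratio is the difference of the two entropy integrands. *)
Lemma ln_weight_ratio u x : Cb S u -> (forall x, 0 < u x) ->
  ln (weight_ratio u x) = log_ratio a nu w x - log_ratio a nu u x
    + (ln (L0 u x / L0 w x) - ln (L0 u (s x) / L0 w (s x))).
Proof.
move=> Cu u0.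
have L0u_gt0 y : 0 < L0 u y by exact: (ruelle0_gt0 nu c_gt0 a_bounds).
rewrite /weight_ratio /log_ratio !ln_div ?posrE ?divr_gt0//; lra.
Qed.

Lemma measurable_ln_continuous (f : X -> R) : continuous f ->
  measurable_fun [set: borelX] (fun x => ln (f x)).
Proof. by move=> cf; apply: measurableT_comp => //; exact: continuous_borel. Qed.

Lemma measurable_log_ratio u : Cb S u -> (forall x, 0 < u x) ->
  measurable_fun [set: borelX] (log_ratio a nu u).
Proof.
move=> Cu u0.
have -> : log_ratio a nu u = (fun x => ln (L0 u x) - ln (u x)).
  apply/funext => x; rewrite /log_ratio ln_div ?posrE//.
  exact: (ruelle0_gt0 nu c_gt0 a_bounds).
apply: measurable_funB; apply: measurable_ln_continuous; last by case: Cu.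
exact: (ruelle0_continuous c_gt0 a_bounds).
Qed.

Lemma measurable_ln_quotient u : Cb S u -> (forall x, 0 < u x) ->
  measurable_fun [set: borelX] (fun x => ln (L0 u x / L0 w x)).
Proof.
move=> Cu u0.
have -> : (fun x => ln (L0 u x / L0 w x)) = (fun x => ln (L0 u x) - ln (L0 w x)).
  by apply/funext => x; rewrite ln_div ?posrE//; exact: (ruelle0_gt0 nu c_gt0 a_bounds).
by apply: measurable_funB; apply: measurable_ln_continuous;
  exact: (ruelle0_continuous c_gt0 a_bounds).
Qed.

Lemma ln_weight_ratio_le u x : Cb S u -> (forall x, 0 < u x) ->
  ln (weight_ratio u x) <= weight_ratio u x - 1.
Proof.
move=> Cu u0.
have L0u_gt0 y : 0 < L0 u y by exact: (ruelle0_gt0 nu c_gt0 a_bounds).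
rewrite -[X in ln X](subrK 1) addrC le_ln1Dx// ltrBrDl subrr.
by rewrite /weight_ratio !divr_gt0.
Qed.

Hypothesis lrw_ge : exists M, forall x, M <= log_ratio a nu w x.

Let int1 r : mu.-integrable setT (EFin \o cst r).
Proof. exact: (@finite_measure_integrable_cst _ _ R mu setT r). Qed.

(** For u = 1 the entropy integrand vanishes, so that [ln_weight_ratio] bounds
    log (L0 w / w) plus a coboundary by an integrable function.  As log (L0 w / w) is
    bounded below, the coboundary is bounded above by an integrable function, hence
    integrable; then log (L0 w / w) is integrable as well. *)
Lemma log_ratio_weight_integrable :
  mu.-integrable setT (EFin \o log_ratio a nu w).
Proof.
have [M Mw] := lrw_ge.
have Cu : Cb S (cst 1 : X -> R).
  by split; [move=> x; exact: cst_continuous|exists 1 => x; rewrite /= normr1].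
have u0 (x : X) : 0 < (cst 1 : X -> R) x by exact: ltr01.
have [Gi G1] := weight_ratio_integral Cu u0.
set G := weight_ratio (cst 1) in Gi G1.
have lr1 x : log_ratio a nu (cst 1) x = 0.
  rewrite /log_ratio ruelle0E Rintegral_cst// divr1.
  have -> : fine (nu setT) = 1 by rewrite probability_setT.
  by rewrite mulr1 ln1.
pose b x := ln (L0 (cst 1) x / L0 w x).
have Gle x : b x - b (s x) + log_ratio a nu w x <= G x - 1.
  have := ln_weight_ratio_le x Cu u0.
  by rewrite ln_weight_ratio// lr1 -/(b x) -/(b (s x)) -/(G x); lra.
have [] := @coboundary_integral _ _ _ mu s ms gibbs_invariant b (fun x => G x - (1 + M)).
- exact: measurable_ln_quotient.
- exact: (integrableB measurableT Gi (int1 (1 + M))).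
- by move=> x; have := Gle x; have := Mw x; lra.
move=> bi _.
pose h x := G x - 1 - (b x - b (s x)) + `|M|.
have hi : mu.-integrable setT (EFin \o h).
  have i1 := integrableB measurableT (integrableB measurableT Gi (int1 1)) bi.
  exact: (integrableD measurableT i1 (int1 `|M|)).
have hi' := integrableD measurableT (integrable_norm hi) (int1 `|M|).
apply: le_integrable hi' => //.
  apply/measurable_EFinP; exact: measurable_log_ratio.
move=> x _ /=; rewrite lee_fin [leRHS]ger0_norm ?addr_ge0// ler_norml.
have hx : log_ratio a nu w x <= `|h x|.
  apply: le_trans (ler_norm _).
  by rewrite /h; have := Gle x; have := normr_ge0 M; lra.
have := Mw x; have := ler_norm (- M); rewrite normrN.
by have := normr_ge0 (h x); have := normr_ge0 M; lra.
Qed.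

(** Since log t <= t - 1 and the likelihood ratio has integral at most 1, its
    logarithm has nonpositive integral; by [ln_weight_ratio] this compares the two
    entropy integrals, the coboundary contributing 0.  If the positive part for u
    is not integrable then the right-hand side is +oo. *)
Lemma weight_minimizes u : Cb S u -> (forall x, 0 < u x) ->
  integral_defined mu (log_ratio a nu u) ->
  (\int[mu]_x (log_ratio a nu w x)%:E <= \int[mu]_x (log_ratio a nu u x)%:E)%E.
Proof.
move=> Cu u0 udef.
have mu_lr := measurable_log_ratio Cu u0.
have mu_lrE := (measurable_EFinP _ _).2 mu_lr.
have wi := log_ratio_weight_integrable.
have [pos|pos] := ltP (\int[mu]_x ((EFin \o log_ratio a nu u)^\+ x))%E +oo%E; last first.
  have {}pos : (\int[mu]_x ((EFin \o log_ratio a nu u)^\+ x))%E = +oo%E.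
    by apply/eqP; rewrite -leye_eq.
  case: udef; first by rewrite pos ltxx.
  move=> neg; rewrite [leRHS]integralE pos addye ?leey//.
  by rewrite eqe_oppLR lt_eqF.
have [Gi G1] := weight_ratio_integral Cu u0.
set G := weight_ratio u in Gi G1.
pose b x := ln (L0 u x / L0 w x).
have Gle x : log_ratio a nu w x - log_ratio a nu u x + (b x - b (s x)) <= G x - 1.
  by have := ln_weight_ratio_le x Cu u0; rewrite ln_weight_ratio//.
(* the positive part bounds the coboundary of ln (L0 u / L0 w) from above *)
pose p x := Num.max (log_ratio a nu u x) 0.
have pi : mu.-integrable setT (EFin \o p).
  apply/integrableP; split.
    by apply/measurable_EFinP; exact: measurable_maxr.
  apply: le_lt_trans pos; rewrite le_eqVlt; apply/orP; left; apply/eqP/eq_integral => x _.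
  by rewrite gee0_abs/= ?lee_fin ?le_max ?lexx ?orbT// funeposE/= EFin_max.
have [] := @coboundary_integral _ _ _ mu s ms gibbs_invariant b
    (fun x => G x - 1 + (p x - log_ratio a nu w x)).
- exact: measurable_ln_quotient.
- exact: (integrableD measurableT (integrableB measurableT Gi (int1 1))
    (integrableB measurableT pi wi)).
- move=> x; have := Gle x; have : log_ratio a nu u x <= p x by rewrite le_max lexx.
  lra.
move=> bi b0.
have hi1 := integrableD measurableT wi bi.
have hi2 := integrableB measurableT (int1 1) Gi.
have hi := integrableD measurableT hi1 hi2.
have le : (\int[mu]_x (log_ratio a nu w x)%:E <=
   \int[mu]_x (log_ratio a nu w x + (b x - b (s x)) + (1 - G x))%:E)%E.
  under [leRHS]eq_integral do rewrite 2!EFinD.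
  rewrite (integralD measurableT hi1 hi2) (integralD measurableT wi bi) b0 adde0.
  rewrite leeDl//.
  have one : (\int[mu]_x (EFin \o cst 1%R) x = 1)%E.
    by rewrite -(probability_setT mu) -[RHS]mul1e -integral_cst.
  by rewrite (integralB measurableT (int1 1) Gi) one sube_ge0// orbT.
apply: le_trans le _.
have Hu x : log_ratio a nu w x + (b x - b (s x)) + (1 - G x) <= log_ratio a nu u x.
  by have := Gle x; lra.
have ui : mu.-integrable setT (EFin \o log_ratio a nu u).
  have hp := integrableD measurableT pi (integrable_norm hi).
  apply: le_integrable hp => // x _ /=.
  have p0 : 0 <= p x by rewrite le_max lexx orbT.
  have up : log_ratio a nu u x <= p x by rewrite le_max lexx.
  rewrite lee_fin [leRHS]ger0_norm ?addr_ge0// ler_norml.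
  have := ler_norm (- (log_ratio a nu w x + (b x - b (s x)) + (1 - G x))).
  rewrite normrN; have := Hu x.
  have := normr_ge0 (log_ratio a nu w x + (b x - b (s x)) + (1 - G x)).
  by lra.
by apply: (le_integral measurableT hi ui) => x _; rewrite lee_fin.
Qed.

End equilibrium.

(** * The variational principle *)

Theorem proposition1 (R : realType) (S : seq_space R)
    (c c' : R) (c_gt0 : 0 < c) (c_lt_c' : c < c')
    (a : nat -> R) (a_bounds : forall k, c < a k < c')
    (expanding :
      (exists2 l : R, dmin a n `^ (- n%:R^-1) @[n --> \oo] --> l & l < 1) \/
      (ereal_sup (range (fun k => \sum_(1 <= n <oo) ((beta a k n)^-1)%:E))
         < +oo)%E)
    (alpha : R) (alpha_itv : 0 < alpha <= 1)
    (nu : probability (measurableTypeR R) R)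
    (nu_full_support : mu_support nu = setT)
    (nu_tails : strong_adapted_tails a nu)
    (A : seqs S -> R)
    (A_bounded : bounded_above A) (A_holder : holder alpha A)
    (A_variation : summable_variation a A)
    (lambda : R) (psi : seqs S -> R)
    (eigen : main_eigenpair a nu alpha A lambda psi)
    (mu : probability (g_sigma_algebraType (@open (seqs S))) R)
    (gibbs : gibbs_state a nu A lambda psi mu) :
  (ln lambda)%:E = (entropy a nu mu + \int[mu]_x (A x)%:E)%E /\
  (entropy a nu mu + \int[mu]_x (A x)%:E)%E = pressure a nu A.
Proof.
case: eigen => lambda_gt0 psi_gt0 [_ Cpsi] eigen.
have [K AK] := A_bounded; have [cA _] := A_holder.
pose w (x : seqs S) := expR (A x) * psi x.
have CexpA : Cb S (expR \o A).
  split; first by move=> x; apply: continuous_comp; [exact: cA|exact: continuous_expR].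
  by exists (expR K) => x; rewrite /= gtr0_norm ?expR_gt0// ler_expR.
have Cw : Cb S w by exact: CbM.
have w_gt0 x : 0 < w x by rewrite mulr_gt0 ?expR_gt0.
have L0w x : ruelle a nu (cst 0) w x = lambda * psi x.
  by rewrite -eigen ruelle0E.
have lrw x : log_ratio a nu w x = ln lambda - A x.
  rewrite /log_ratio L0w ln_div ?posrE//; last exact: mulr_gt0.
  by rewrite !lnM ?posrE ?expR_gt0// expRK; lra.
have gibbs_w phi : Cb S phi -> (\int[mu]_x (phi x)%:E =
  \int[mu]_x (ruelle a nu (cst 0) (fun y => w y * phi y)%R x
     / ruelle a nu (cst 0) w x)%:E)%E.
  move=> Cphi; rewrite (gibbs _ Cphi); apply: eq_integral => x _; congr EFin.
  rewrite ruelle0E -RintegralZr//; last first.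
    exact: (pre_integrable nu c_gt0 a_bounds _ (CbM Cw Cphi)).
  apply: eq_Rintegral => r _.
  rewrite /normalized (shift_pre c_gt0 a_bounds) L0w /w.
  rewrite !expRD !expRN !lnK ?posrE//.
  by field; rewrite !gt_eqF.
have mA : measurable_fun [set: g_sigma_algebraType (@open (seqs S))] A.
  exact: continuous_borel.
have lrw_ge : exists M, forall x, M <= log_ratio a nu w x.
  by exists (ln lambda - K) => x; rewrite lrw lerD2l lerN2.
have wi := log_ratio_weight_integrable c_gt0 a_bounds Cw w_gt0 gibbs_w lrw_ge.
have lrwE (m : probability (g_sigma_algebraType (@open (seqs S))) R) :
    (\int[m]_x (ln lambda - A x)%:E = \int[m]_x (log_ratio a nu w x)%:E)%E.
  by apply: eq_integral => x _; rewrite lrw.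
have le_ent (m : probability (g_sigma_algebraType (@open (seqs S))) R) :
    (entropy a nu m <= \int[m]_x (ln lambda - A x)%:E)%E.
  rewrite lrwE; apply: ereal_inf_lbound; exists w => //; split => //; right.
  have [M Mw] := lrw_ge.
  apply: (funeneg_integral_lty m _ Mw).
  exact: (measurable_log_ratio nu c_gt0 a_bounds Cw w_gt0).
have intA (m : probability (g_sigma_algebraType (@open (seqs S))) R) :
    m.-integrable setT (EFin \o A) ->
    (\int[m]_x (ln lambda - A x)%:E = (ln lambda)%:E - \int[m]_x (A x)%:E)%E.
  move=> Ai; have ci := @finite_measure_integrable_cst _ _ R m setT (ln lambda) measurableT.
  under eq_integral do rewrite EFinB.
  rewrite (integralB measurableT ci Ai); congr (_ - _)%E.
  by rewrite -[RHS]mule1 -(probability_setT m) -integral_cst.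
have upper (m : probability (g_sigma_algebraType (@open (seqs S))) R) :
    (entropy a nu m + \int[m]_x (A x)%:E <= (ln lambda)%:E)%E.
  have [Ai|nAi] := pselect (m.-integrable setT (EFin \o A)).
    have Afin := integrable_fin_num measurableT Ai.
    by rewrite -(leeBrDr _ _ Afin) -(intA m Ai); exact: le_ent.
  by rewrite (integral_bounded_above mA AK nAi) addeNy leNye.
have Ai : mu.-integrable setT (EFin \o A).
  have ci := @finite_measure_integrable_cst _ _ R mu setT (ln lambda) measurableT.
  apply: eq_integrable (integrableB measurableT ci wi) => // x _ /=.
  by rewrite -EFinB lrw; congr EFin; lra.
have ent : entropy a nu mu = ((ln lambda)%:E - \int[mu]_x (A x)%:E)%E.
  rewrite -intA//; apply/eqP; rewrite eq_le le_ent/= lrwE.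
  apply: le_ereal_inf_tmp => _ [u [Cu u_gt0 udef] <-].
  exact: (weight_minimizes c_gt0 a_bounds Cw w_gt0 gibbs_w lrw_ge).
have first : (entropy a nu mu + \int[mu]_x (A x)%:E)%E = (ln lambda)%:E.
  by rewrite ent subeK//; exact: integrable_fin_num.
split=> //; rewrite first; apply/eqP; rewrite eq_le; apply/andP; split.
  rewrite -first; apply: ereal_sup_ubound; exists mu => //.
  exact: (gibbs_invariant c_gt0 a_bounds Cw w_gt0 gibbs_w).
by apply: ge_ereal_sup => _ [m _ <-]; exact: upper.
Qed.
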